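(* Let $\mathcal{S}=\{1,\dots,S\}$, let $\mathcal{Y}^s\subseteq\mathbb{R}^p$, $s\in\mathcal{S}$, be finite non-empty sets, and let $\mathcal{Y}=\bigoplus_{s\in\mathcal{S}}\mathcal{Y}^s$. Let $\mathcal{L}^s,\mathcal{U}^s\subseteq\mathbb{R}^p$, $s\in\mathcal{S}$, be stable sets with $\mathcal{L}^s\leqq\mathcal{Y}^s_{\mathrm N}\leqq\mathcal{U}^s$ for all $s\in\mathcal{S}$. If for some $\bar s\in\mathcal{S}$ there exists a vector $y^{\bar s}\in\mathcal{Y}^{\bar s}$ which satisfies the set inequality $$\Bigl(\bigoplus_{s\in\mathcal{S}}\mathcal{U}^s\Bigr)_{\mathrm N}<\Bigl(\{y^{\bar s}\}\oplus\bigl(\bigoplus_{s\in\mathcal{S}\setminus\{\bar s\}}\mathcal{L}^s\bigr)\Bigr)_{\mathrm N},$$ then $y^{\bar s}\notin\mathcal{G}^{\bar s}$ for any minimal generator set $\mathcal{G}=\{\mathcal{G}^1,\dots,\mathcal{G}^S\}$.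
   Context: For sets $A^s\subseteq\mathbb{R}^p$, $\bigoplus_s A^s=\{\sum_s a^s\mid a^s\in A^s\}$ is the Minkowski sum (with the usual convention that an empty sum is $\{0\}$), and $A\oplus B$ is the Minkowski sum of two sets. For $u,v\in\mathbb{R}^p$: $u\leqq v$ means $u_i\le v_i$ for all $i\in\{1,\dots,p\}$; $u\leq v$ means $u\leqq v$ and $u\ne v$. For $A\subseteq\mathbb{R}^p$, $A_{\mathrm N}=\{a\in A\mid\nexists a'\in A:a'\leq a\}$ is the nondominated set of $A$; in particular $\mathcal{Y}^s_{\mathrm N}$ and $\mathcal{Y}_{\mathrm N}$ are the nondominated sets of $\mathcal{Y}^s$ and $\mathcal{Y}$. A set $A$ is stable if $A=A_{\mathrm N}$. For stable sets $A,B\subseteq\mathbb{R}^p$: $A\leqq B$ means that for all $b\in B$ there is $a\in A$ with $a\leqq b$; $A<B$ means that for all $b\in B$ there is $a\in A$ with $a\leq b$ (that is, $a\leqq b$ and $a\ne b$). A generator set is a family $\mathcal{G}=\{\mathcal{G}^1,\dots,\mathcal{G}^S\}$ (indexed by $\mathcal{S}$) of stable sets $\mathcal{G}^s\subseteq\mathcal{Y}^s$ with $\mathcal{Y}_{\mathrm N}=(\bigoplus_{s\in\mathcal{S}}\mathcal{G}^s)_{\mathrm N}$. A generator set $\mathcal{G}$ is minimal if there does not exist $\tilde{\mathcal{G}}=\{\tilde{\mathcal{G}}^1,\dots,\tilde{\mathcal{G}}^S\}$ with $\tilde{\mathcal{G}}^s\subseteq\mathcal{G}^s$ for all $s\in\mathcal{S}$,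 with at least one strict inclusion, such that $\mathcal{Y}_{\mathrm N}=(\bigoplus_{s\in\mathcal{S}}\tilde{\mathcal{G}}^s)_{\mathrm N}$.
   Formalization: Added assumption: every vector of {y^s̄} ⊕ (⊕_{s≠s̄} L^s) is weakly dominated by a nondominated vector of that set (automatic for finite L^s); without it the claim fails, since for infinite L^s the right-hand nondominated set may be empty. *)

(* Defs.v *)
From mathcomp Require Import all_boot all_order all_algebra.
From mathcomp Require Import boolp classical_sets functions cardinality reals.

Set Implicit Arguments.
Unset Strict Implicit.
Unset Printing Implicit Defensive.

Import Order.TTheory GRing.Theory Num.Theory.
Local Open Scope classical_set_scope.
Local Open Scope ring_scope.

Section Vectors.
Variables (R : realType) (p : nat).
Implicit Types (u v : 'rV[R]_p) (A B : set 'rV[R]_p).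

(* Componentwise order, written with a double-barred inequality in the
   multi-objective optimization literature. *)
Definition vleqq u v : Prop := forall i : 'I_p, u 0 i <= v 0 i.

(* Pareto dominance: [vleqq] and different, not strict in every component. *)
Definition vleq u v : Prop := vleqq u v /\ u <> v.

Definition nondominated A : set 'rV[R]_p :=
  [set a | A a /\ ~ (exists a', A a' /\ vleq a' a)].

Definition stable A : Prop := A = nondominated A.

(* The two set relations are only meant to be used on stable sets. *)
Definition set_leqq A B : Prop := forall b, B b -> exists a, A a /\ vleqq a b.

Definition set_lt A B : Prop := forall b, B b -> exists a, A a /\ vleq a b.

(* External stability (domination property): every element of A is weakly
   dominated by a nondominated element of A.  It can fail for infinite A, for
   which [nondominated A] may even be empty. *)
Definition externally_stable A : Prop :=
  forall b, A b -> exists a, nondominated A a /\ vleqq a b.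

Definition minkowski_add A B : set 'rV[R]_p := [set a + b | a in A & b in B].

(* Minkowski sum of the A s over the indices s satisfying P; only the values
   of the selection a at those indices matter, and the sum over no index is
   [set 0]. *)
Definition minkowski_sum (I : finType) (P : pred I)
    (A : I -> set 'rV[R]_p) : set 'rV[R]_p :=
  [set y | exists a : I -> 'rV[R]_p,
     (forall s, P s -> A s (a s)) /\ y = \sum_(s | P s) a s].

End Vectors.

Section Generators.
Variables (R : realType) (p : nat) (I : finType).
Implicit Types Y G : I -> set 'rV[R]_p.

Definition generates Y G : Prop :=
  nondominated (minkowski_sum xpredT Y) = nondominated (minkowski_sum xpredT G).

Definition generator_set Y G : Prop :=
  [/\ forall s, stable (G s), forall s, G s `<=` Y s & generates Y G].

Definition minimal_generator_set Y G : Prop :=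
  generator_set Y G /\
  ~ (exists H : I -> set 'rV[R]_p,
       [/\ forall s, H s `<=` G s, exists s, H s `<` G s & generates Y H]).

End Generators.

Section FiniteSets.
Variables (R : realType) (p : nat).
Implicit Types A B : set 'rV[R]_p.

Lemma finite_externally_stable A : finite_set A -> externally_stable A.
Proof.
case/finite_seqP=> l ->.
pose f (v : 'rV[R]_p) := \sum_i v 0 i.
have vle_f u v : vleq u v -> f u < f v.
  case=> le_uv ne_uv; have /existsP[i ne_i] : [exists i, u 0 i != v 0 i].
    apply: contrapT => /negP /existsPn eq_uv; apply: ne_uv; apply/rowP => i.
    by apply/eqP; have /negbNE := eq_uv i.
  rewrite /f (bigD1 i) //= [ltRHS](bigD1 i) //=.
  by rewrite ltr_leD ?lt_neqAle ?ne_i ?le_uv // ler_sum // => j _; exact: le_uv.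
move=> b; have [k] := ubnP (size [seq x <- l | f x < f b]).
elim: k b => // k IHk b lt_k b_l.
have [[a [a_l a_b]]|no_a] := pselect (exists a, [set` l] a /\ vleq a b); last first.
  by exists b; split=> //; split.
have lt_ab := vle_f _ _ a_b.
have [|a' [nd_a' le_a']] := IHk a _ a_l; last first.
  by exists a'; split=> // i; exact: le_trans (le_a' i) (a_b.1 i).
rewrite ltnS in lt_k; apply: leq_trans lt_k.
have -> : [seq x <- l | f x < f a] = [seq x <- [seq x <- l | f x < f b] | f x < f a].
  rewrite -filter_predI; apply: eq_filter => x /=.
  by rewrite andb_idr // => /lt_trans; apply.
rewrite size_filter -(count_predC (fun x => f x < f a) [seq x <- l | f x < f b]).
rewrite -[ltnLHS]addn0 ltn_add2l -has_count; apply/hasP; exists a.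
  by rewrite mem_filter lt_ab.
by rewrite /= ltxx.
Qed.

Lemma finite_minkowski_add A B :
  finite_set A -> finite_set B -> finite_set (minkowski_add A B).
Proof. exact: finite_image2. Qed.

Lemma finite_minkowski_sum (I : finType) (P : pred I)
    (A : I -> set 'rV[R]_p) :
  (forall s, P s -> finite_set (A s)) -> finite_set (minkowski_sum P A).
Proof.
move=> finA.
have fin_big (r : seq I) : finite_set
    [set y | exists a : I -> 'rV[R]_p,
       (forall s, P s -> A s (a s)) /\ y = \sum_(s <- r | P s) a s].
  elim: r => [|s r IHr].
    by apply: (sub_finite_set _ (finite_set1 0)) => y [a [_ ->]]; rewrite big_nil.
  have [Ps|nPs] := boolP (P s); last first.
    apply: sub_finite_set IHr => y [a [Aa ->]].
    by exists a; rewrite big_cons (negbTE nPs).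
  apply: sub_finite_set (finite_minkowski_add (finA s Ps) IHr).
  move=> y [a [Aa ->]]; rewrite big_cons Ps.
  by exists (a s); [exact: Aa | exists (\sum_(t <- r | P t) a t) => //; exists a].
exact: fin_big.
Qed.

End FiniteSets.

(* Main.v *)
Require Import Defs.
From mathcomp Require Import all_boot all_order all_algebra.
From mathcomp Require Import boolp classical_sets functions cardinality reals.

(** The bounds force [ybar] to be useless. Let [y] be a sum of choices from the
    [Y s] whose component at [sbar] is [ybar]. Replacing the other components by
    elements of the [L s] below them gives a point below [y] in the sum of
    [ybar] with the lower bounds; external stability of that sum lets one
    descend to a nondominated point of it, which the assumed set inequality
    places strictly (in the sense of [vleq]) above a sum of upper bounds, and
    each element of [U s] lies above some element of [Y s]. Hence [y] is
    dominated in the full sum of the [Y s] ([sum_through_dominated]).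

    Consequently no nondominated point of the full sum has a decomposition
    through [ybar], so deleting [ybar] from [G sbar] keeps every nondominated
    point ([minimal_generator_used]). Since the sums are finite, this is enough
    for the smaller family to have the same nondominated set
    ([nondominated_eq_sub]), which contradicts minimality. *)

Set Implicit Arguments.
Unset Strict Implicit.
Unset Printing Implicit Defensive.

Import Order.TTheory GRing.Theory Num.Theory.
Local Open Scope classical_set_scope.
Local Open Scope ring_scope.

Section ParetoOrder.
Variables (R : realType) (p : nat).
Implicit Types (u v w : 'rV[R]_p) (A B C : set 'rV[R]_p).

Lemma vleqq_trans u v w : vleqq u v -> vleqq v w -> vleqq u w.
Proof. by move=> uv vw i; exact: le_trans (uv i) (vw i). Qed.

Lemma vleqq_anti u v : vleqq u v -> vleqq v u -> u = v.
Proof. by move=> uv vu; apply/rowP => i; apply/le_anti; rewrite uv vu. Qed.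

Lemma vleq_vleqq_trans u v w : vleq u v -> vleqq v w -> vleq u w.
Proof.
move=> [uv neq_uv] vw; split; first exact: vleqq_trans vw.
by move=> uw; apply: neq_uv; apply: vleqq_anti; rewrite // uw.
Qed.

Lemma vleqq_vleq_trans u v w : vleqq u v -> vleq v w -> vleq u w.
Proof.
move=> uv [vw neq_vw]; split; first exact: vleqq_trans vw.
by move=> uw; apply: neq_vw; apply: vleqq_anti; rewrite // -uw.
Qed.

Lemma set_leqq_trans A B C : set_leqq A B -> set_leqq B C -> set_leqq A C.
Proof.
move=> AB BC c /BC[b [/AB[a [Aa ab]] bc]].
by exists a; split=> //; exact: vleqq_trans bc.
Qed.

Lemma set_leqq_sub A B C : A `<=` B -> set_leqq A C -> set_leqq B C.
Proof. by move=> AB AC c /AC[a [/AB Ba ac]]; exists a. Qed.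

Lemma minkowski_sum_sub (I : finType) (P : pred I) (F H : I -> set 'rV[R]_p) :
  (forall s, P s -> F s `<=` H s) -> minkowski_sum P F `<=` minkowski_sum P H.
Proof.
by move=> FH _ [f [Ff ->]]; exists f; split=> // s Ps; apply: FH => //; apply: Ff.
Qed.

Lemma minkowski_sum_leqq (I : finType) (P : pred I) (F H : I -> set 'rV[R]_p) :
  (forall s, P s -> set_leqq (F s) (H s)) ->
  set_leqq (minkowski_sum P F) (minkowski_sum P H).
Proof.
move=> FH _ [h [Hh ->]].
have /choice[f fP] s : exists a, P s -> F s a /\ vleqq a (h s).
  have [Ps|_] := boolP (P s); last by exists 0.
  by have [a ?] := FH s Ps _ (Hh s Ps); exists a.
exists (\sum_(s | P s) f s); split.
  by exists f; split=> // s /fP[].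
by move=> i; rewrite !summxE; apply: ler_sum => s /fP[_]; apply.
Qed.

(** Discarding dominated points could only create new nondominated points, by
    removing what dominated them.  It does not, since whatever dominates a
    point of [B] in [A] is itself weakly dominated by a nondominated point of
    [A], and that point lies in [B]. *)
Lemma nondominated_eq_sub A B : externally_stable A ->
  B `<=` A -> nondominated A `<=` B -> nondominated A = nondominated B.
Proof.
move=> extA BA ndAB; apply/seteqP; split=> y.
  move=> ndy; split; first exact: ndAB.
  by move=> [z [/BA Az zy]]; apply: ndy.2; exists z.
move=> [By ndy]; split; first exact: BA.
move=> [z [/extA[x [ndx xz]] zy]]; apply: ndy.
by exists x; split; [exact: ndAB | exact: vleqq_vleq_trans zy].
Qed.

(** The domination is by [vleq] only at the step from the sum of upper bounds to
    the nondominated part of the sum of lower bounds; the other steps are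
    by [vleqq], which can be composed with [vleq] on either side. *)
Lemma sum_through_dominated (I : finType) (Y L U : I -> set 'rV[R]_p)
    (t : I) (g : I -> 'rV[R]_p) :
  (forall s, set_leqq (L s) (Y s)) -> (forall s, set_leqq (Y s) (U s)) ->
  externally_stable
    (minkowski_add [set g t] (minkowski_sum (fun s => s != t) L)) ->
  set_lt (nondominated (minkowski_sum xpredT U))
    (nondominated
       (minkowski_add [set g t] (minkowski_sum (fun s => s != t) L))) ->
  (forall s, Y s (g s)) ->
  exists y, minkowski_sum xpredT Y y /\ vleq y (\sum_s g s).
Proof.
move=> LY YU extL UL Yg; rewrite (bigD1 t) //=.
have [l [sumLl le_lg]] : exists l,
    minkowski_sum (fun s => s != t) L l /\ vleqq l (\sum_(s | s != t) g s).
  by apply: (minkowski_sum_leqq (fun s _ => LY s)); exists g.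
have [|a [nda le_al]] := extL (g t + l).
  by exists (g t) => //; exists l.
have [u [[sumUu _] lt_ua]] := UL a nda.
have [y [sumYy le_yu]] := minkowski_sum_leqq (fun s _ => YU s) sumUu.
exists y; split=> //; apply: vleqq_vleq_trans le_yu _.
apply: vleq_vleqq_trans lt_ua _; apply: vleqq_trans le_al _.
by move=> i; rewrite !mxE lerD2l; exact: le_lg.
Qed.

End ParetoOrder.

(** Deleting [v] from [G t] is an admissible shrinking of the family, so
    it must lose the generating property; the only nondominated points that can
    get lost are those all of whose decompositions over [G] use [v] at [t]. *)
Lemma minimal_generator_used (R : realType) (p : nat) (I : finType)
    (Y G : I -> set 'rV[R]_p) (t : I) (v : 'rV[R]_p) :
  (forall s, finite_set (Y s)) -> minimal_generator_set Y G -> G t v ->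
  exists g : I -> 'rV[R]_p, [/\ forall s, Y s (g s), g t = v
    & nondominated (minkowski_sum xpredT Y) (\sum_s g s)].
Proof.
move=> finY [[_ GY genG] minG] Gv; apply: contrapT => unused; apply: minG.
pose H s := [set y | G s y /\ (s = t -> y <> v)].
have HG s : H s `<=` G s by move=> y [].
exists H; split=> //.
  exists t; split; first exact: HG.
  by move=> /(_ v Gv)[_ /(_ erefl)].
rewrite /generates genG; apply: nondominated_eq_sub.
- apply: finite_externally_stable; apply: finite_minkowski_sum => s _.
  exact: sub_finite_set (GY s) (finY s).
- exact: minkowski_sum_sub.
move=> y ndy; have [[g [Gg yE]] _] := ndy; exists g; split=> // s _.
split=> [|-> gv]; first exact: Gg.
apply: unused; exists g; split=> //; first by move=> r; apply: GY; apply: Gg.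
by rewrite -yE genG.
Qed.

Theorem proposition3p7 (R : realType) (p S : nat)
    (Y L U : 'I_S -> set 'rV[R]_p)
    (Y_finite : forall s, finite_set (Y s))
    (Y_nonempty : forall s, Y s !=set0)
    (L_stable : forall s, stable (L s))
    (U_stable : forall s, stable (U s))
    (L_le_Y : forall s, set_leqq (L s) (nondominated (Y s)))
    (Y_le_U : forall s, set_leqq (nondominated (Y s)) (U s))
    (sbar : 'I_S) (ybar : 'rV[R]_p) (ybar_Y : Y sbar ybar)
    (L_ext : externally_stable
       (minkowski_add [set ybar] (minkowski_sum (fun s => s != sbar) L)))
    (U_lt_L : set_lt
       (nondominated (minkowski_sum xpredT U))
       (nondominated
          (minkowski_add [set ybar] (minkowski_sum (fun s => s != sbar) L)))) :
  forall G : 'I_S -> set 'rV[R]_p,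
    minimal_generator_set Y G -> ~ G sbar ybar.
Proof.
move=> G minG Gybar.
have [g [Yg gE [_ []]]] := minimal_generator_used Y_finite minG Gybar.
rewrite -gE in L_ext U_lt_L.
apply: sum_through_dominated L_ext U_lt_L Yg => s.
- apply: set_leqq_trans (L_le_Y s) _.
  exact: finite_externally_stable.
- by apply: set_leqq_sub (Y_le_U s) => y [].
Qed.
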